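(* Beltrami's theorem fails for metric connections with vectorial torsion. More precisely, let $C\subset\mathbb{R}^3$ be the catenoid and $S^2\setminus\{\text{poles}\}$ the unit sphere without its two poles, both viewed as surfaces of revolution about the $z$-axis with their induced metrics, and equip each of them with its metric connection with vectorial torsion defined by the vector field $V=\frac{r'(s)}{r(s)}\,\partial_s$ (see context). Then the Gauss map $C\to S^2\setminus\{\text{poles}\}$ maps geodesics of the connection on $C$, up to reparametrisation, to geodesics of the connection on $S^2\setminus\{\text{poles}\}$, although the sphere has constant Gaussian curvature and the catenoid does not.
   Context: For a Riemannian manifold $(M,g)$ with Levi-Civita connection $\nabla^g$ and a smooth vector field $V$ on $M$, the metric connection with vectorial torsion defined by $V$ is $\nabla_XY=\nabla^g_XY+g(X,Y)V-g(V,Y)X$; a $\nabla$-geodesic is a non-constant curve $\gamma$ with $\nabla_{\dot\gamma}\dot\gamma=0$. Surfaces of revolution: let $\alpha(s)=(r(s),h(s))$, $r>0$, be a curve parametrised by arc length and $M(s,\varphi)=(r(s)\cos\varphi,r(s)\sin\varphi,h(s))$ the surface of revolution generated by it, with induced metric $g=ds^2+r(s)^2\,d\varphi^2$. The connection considered on it is the metric connection with vectorial torsion defined by $V=\frac{r'(s)}{r(s)}\,\partial_s$. It is the flat metric connection for which the orthonormal frame $\partial_s,\ \frac1r\partial_\varphi$ is parallel; its geodesics are the loxodromes, i.e. the curves of constant speed making a constant angle with the meridians. For the sphere, $r(s)=\sin s$, $h(s)=\cos s$, $0<s<\pi$; for the catenoid, $r(s)=\sqrt{1+s^2}$, $h(s)=\operatorname{arcsinh}(s)$,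 $s\in\mathbb{R}$. The Gauss map sends a point of $C$ to a (continuously chosen) unit normal vector of $C$ at that point. Beltrami's theorem (classical): if a portion of a surface $S$ can be mapped onto a portion of a surface $S^*$ of constant Gaussian curvature by a map sending Levi-Civita geodesics to Levi-Civita geodesics, then the Gaussian curvature of $S$ is also constant. *)

(* Defs.v *)
From Stdlib Require Import Reals Lra.
From Coquelicot Require Import Coquelicot.

Open Scope R_scope.

(** * Vectors in R^3 *)

Definition R3 : Type := (R * R * R)%type.

Definition dot (p q : R3) : R :=
  fst (fst p) * fst (fst q) + snd (fst p) * snd (fst q) + snd p * snd q.

Definition cross (p q : R3) : R3 :=
  (snd (fst p) * snd q - snd p * snd (fst q),
   snd p * fst (fst q) - fst (fst p) * snd q,
   fst (fst p) * snd (fst q) - snd (fst p) * fst (fst q)).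

Definition scal3 (a : R) (p : R3) : R3 :=
  (a * fst (fst p), a * snd (fst p), a * snd p).

(** * Coordinates on a surface

    Points of the parameter domain are pairs [u : R * R]; tangent vectors are
    given by their components in the coordinate frame, [idx -> R]. *)

Inductive idx : Set := I1 | I2.

Definition coord (i : idx) (u : R * R) : R :=
  match i with I1 => fst u | I2 => snd u end.

Definition sum2 (f : idx -> R) : R := f I1 + f I2.

Definition partial (i : idx) (f : R * R -> R) (u : R * R) : R :=
  match i with
  | I1 => Derive (fun x => f (x, snd u)) (fst u)
  | I2 => Derive (fun y => f (fst u, y)) (snd u)
  end.

Definition partial3 (i : idx) (X : R * R -> R3) (u : R * R) : R3 :=
  (partial i (fun w => fst (fst (X w))) u,
   partial i (fun w => snd (fst (X w))) u,
   partial i (fun w => snd (X w)) u).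

(** * Riemannian metrics in coordinates *)

Definition metric : Type := R * R -> idx -> idx -> R.

Definition inner (g : metric) (u : R * R) (v w : idx -> R) : R :=
  sum2 (fun i => sum2 (fun j => g u i j * v i * w j)).

Definition det2 (A : idx -> idx -> R) : R :=
  A I1 I1 * A I2 I2 - A I1 I2 * A I2 I1.

Definition inv2 (A : idx -> idx -> R) (i j : idx) : R :=
  match i, j with
  | I1, I1 => A I2 I2 / det2 A
  | I2, I2 => A I1 I1 / det2 A
  | _, _ => - A i j / det2 A
  end.

Definition christoffel (g : metric) (k i j : idx) (u : R * R) : R :=
  / 2 * sum2 (fun l => inv2 (g u) k l *
    (partial i (fun w => g w j l) u + partial j (fun w => g w i l) u
     - partial l (fun w => g w i j) u)).

Lemma partial_ext (i : idx) (f h : R * R -> R) (u : R * R) :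
  (forall w, f w = h w) -> partial i f u = partial i h u.
Proof. intros H; destruct i; apply Derive_ext; intros; apply H. Qed.

(** The connection given by [christoffel] is torsion free and metric. *)
Lemma christoffel_sym (g : metric) (k i j : idx) (u : R * R) :
  (forall w a b, g w a b = g w b a) ->
  christoffel g k i j u = christoffel g k j i u.
Proof.
intros Hg; unfold christoffel, sum2.
rewrite (partial_ext I1 (fun w => g w i j) (fun w => g w j i)) by (intros; apply Hg).
rewrite (partial_ext I2 (fun w => g w i j) (fun w => g w j i)) by (intros; apply Hg).
ring.
Qed.

Lemma christoffel_metric (g : metric) (k i j : idx) (u : R * R) :
  (forall w a b, g w a b = g w b a) -> det2 (g u) <> 0 ->
  partial k (fun w => g w i j) u =
  sum2 (fun l => christoffel g l k i u * g u l j)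
  + sum2 (fun l => christoffel g l k j u * g u i l).
Proof.
intros Hg Hd; unfold christoffel, sum2, inv2, det2 in *.
pose proof (partial_ext I1 (fun w => g w I2 I1) (fun w => g w I1 I2) u
              (fun w => Hg w I2 I1)) as E1.
pose proof (partial_ext I2 (fun w => g w I2 I1) (fun w => g w I1 I2) u
              (fun w => Hg w I2 I1)) as E2.
rewrite (Hg u I2 I1) in *.
destruct k, i, j; rewrite ?E1, ?E2, ?(Hg u I2 I1); field; assumption.
Qed.

Definition velocity (c : R -> R * R) (t : R) (k : idx) : R :=
  Derive (fun x => coord k (c x)) t.

(** [levi_civita_along g c Y t k] is the [k]-th component of the Levi-Civita
    covariant derivative at time [t] of the field [Y] along the curve [c]. *)
Definition levi_civita_along (g : metric) (c : R -> R * R) (Y : R -> idx -> R)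
    (t : R) (k : idx) : R :=
  Derive (fun x => Y x k) t
  + sum2 (fun i => sum2 (fun j =>
      christoffel g k i j (c t) * velocity c t i * Y t j)).

(** The metric connection with vectorial torsion defined by [V],
    [nabla_X Y = nabla^g_X Y + g(X,Y) V - g(V,Y) X], with [X] the velocity
    of [c]. *)
Definition vectorial_torsion_along (g : metric) (V : R * R -> idx -> R)
    (c : R -> R * R) (Y : R -> idx -> R) (t : R) (k : idx) : R :=
  levi_civita_along g c Y t k
  + inner g (c t) (velocity c t) (Y t) * V (c t) k
  - inner g (c t) (V (c t)) (Y t) * velocity c t k.

(** * Surfaces of revolution *)

Definition is_open_interval (I : R -> Prop) : Prop :=
  open I /\ (forall x y z, I x -> I z -> x <= y <= z -> I y).

Record profile : Type := Profile {
  dom : R -> Prop;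
  rad : R -> R;
  hgt : R -> R;
  dom_interval : is_open_interval dom;
  rad_gt0 : forall s, dom s -> 0 < rad s;
  profile_derivable : forall s, dom s -> ex_derive rad s /\ ex_derive hgt s;
  profile_unit_speed :
    forall s, dom s -> Derive rad s ^ 2 + Derive hgt s ^ 2 = 1
}.

Definition param_dom (M : profile) (u : R * R) : Prop := dom M (fst u).

Definition param (M : profile) (u : R * R) : R3 :=
  (rad M (fst u) * cos (snd u), rad M (fst u) * sin (snd u), hgt M (fst u)).

Definition on_surface (M : profile) (p : R3) : Prop :=
  exists u, param_dom M u /\ param M u = p.

Definition induced_metric (M : profile) : metric := fun u i j =>
  dot (partial3 i (param M) u) (partial3 j (param M) u).

Definition torsion_field (M : profile) (u : R * R) (k : idx) : R :=
  match k with
  | I1 => Derive (rad M) (fst u) / rad M (fst u)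
  | I2 => 0
  end.

(** [gamma], restricted to the interval [I], is a geodesic of the connection
    with vectorial torsion of [M]. Since [param M] is only locally injective,
    the equation is expressed in the coordinates [(s, phi)] near each time.
    The two derivatives needed to write the equation are all that is asked;
    its solutions are then automatically smooth. *)
Definition geodesic (M : profile) (I : R -> Prop) (gamma : R -> R3) : Prop :=
  (exists t1 t2, I t1 /\ I t2 /\ gamma t1 <> gamma t2) /\
  (forall t0, I t0 -> exists c : R -> R * R,
     locally t0 (fun t =>
       param_dom M (c t) /\ param M (c t) = gamma t /\
       forall k,
         ex_derive (fun x => coord k (c x)) t /\
         ex_derive (fun x => velocity c x k) t /\
         vectorial_torsion_along (induced_metric M) (torsion_field M)
           c (velocity c) t k = 0)).

Definition reparametrisation (J I : R -> Prop) (psi : R -> R) : Prop :=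
  is_open_interval J /\
  (forall x, J x -> I (psi x)) /\
  (forall t, I t -> exists x, J x /\ psi x = t) /\
  (forall x, J x -> ex_derive psi x /\ ex_derive (Derive psi) x /\
                    Derive psi x <> 0).

Definition gauss_map (M : profile) (N : R3 -> R3) : Prop :=
  continuous_on (on_surface M) N /\
  (forall p, on_surface M p -> dot (N p) (N p) = 1) /\
  (forall u i, param_dom M u ->
     dot (N (param M u)) (partial3 i (param M) u) = 0).

Definition unit_normal (M : profile) (u : R * R) : R3 :=
  let n := cross (partial3 I1 (param M) u) (partial3 I2 (param M) u) in
  scal3 (/ sqrt (dot n n)) n.

Definition second_form (M : profile) (u : R * R) (i j : idx) : R :=
  dot (partial3 i (partial3 j (param M)) u) (unit_normal M u).

(** Determinant of the shape operator. *)
Definition gaussian_curvature (M : profile) (u : R * R) : R :=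
  det2 (second_form M u) / det2 (induced_metric M u).

Definition constant_curvature (M : profile) : Prop :=
  exists k, forall u, param_dom M u -> gaussian_curvature M u = k.

(** * The catenoid and the sphere without its poles *)

Lemma is_derive_sqrt1 (s : R) :
  is_derive (fun x => sqrt (1 + x ^ 2)) s (s / sqrt (1 + s ^ 2)).
Proof.
assert (0 < 1 + s ^ 2) by nra.
assert (0 < sqrt (1 + s ^ 2)) by (apply sqrt_lt_R0; assumption).
auto_derive; [assumption | simpl in *; field; lra].
Qed.

Lemma is_derive_arcsinh (s : R) : is_derive arcsinh s (/ sqrt (1 + s ^ 2)).
Proof.
apply is_derive_Reals.
replace (1 + s ^ 2) with (s ^ 2 + 1) by ring.
apply derivable_pt_lim_arcsinh.
Qed.

Lemma line_interval : is_open_interval (fun _ : R => True).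
Proof. split; [apply open_true | trivial]. Qed.

Lemma sphere_interval : is_open_interval (fun s => 0 < s < PI).
Proof.
split; [| intros; lra].
apply open_and; [apply open_gt | apply open_lt].
Qed.

Lemma catenoid_rad_gt0 (s : R) : True -> 0 < sqrt (1 + s ^ 2).
Proof. intros _; apply sqrt_lt_R0; nra. Qed.

Lemma catenoid_derivable (s : R) : True ->
  ex_derive (fun x => sqrt (1 + x ^ 2)) s /\ ex_derive arcsinh s.
Proof.
intros _; split; eexists; [apply is_derive_sqrt1 | apply is_derive_arcsinh].
Qed.

Lemma catenoid_unit_speed (s : R) : True ->
  Derive (fun x => sqrt (1 + x ^ 2)) s ^ 2 + Derive arcsinh s ^ 2 = 1.
Proof.
intros H.
replace (Derive (fun x => sqrt (1 + x ^ 2)) s) with (s / sqrt (1 + s ^ 2))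
  by (symmetry; apply is_derive_unique, is_derive_sqrt1).
replace (Derive arcsinh s) with (/ sqrt (1 + s ^ 2))
  by (symmetry; apply is_derive_unique, is_derive_arcsinh).
pose proof (catenoid_rad_gt0 s H).
assert (E : sqrt (1 + s ^ 2) ^ 2 = 1 + s ^ 2) by (apply pow2_sqrt; nra).
apply (Rmult_eq_reg_r (sqrt (1 + s ^ 2) ^ 2)); [| rewrite E; nra].
transitivity (s ^ 2 + 1); [field; lra | lra].
Qed.

Lemma sphere_derivable (s : R) : 0 < s < PI -> ex_derive sin s /\ ex_derive cos s.
Proof. intros _; split; auto_derive; trivial. Qed.

Lemma sphere_unit_speed (s : R) : 0 < s < PI ->
  Derive sin s ^ 2 + Derive cos s ^ 2 = 1.
Proof.
intros _.
replace (Derive sin s) with (cos s)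
  by (symmetry; apply is_derive_unique, is_derive_sin).
replace (Derive cos s) with (- sin s)
  by (symmetry; apply is_derive_unique, is_derive_cos).
pose proof (sin2_cos2 s) as H; unfold Rsqr in H; lra.
Qed.

Definition catenoid : profile :=
  Profile (fun _ => True) (fun s => sqrt (1 + s ^ 2)) arcsinh
    line_interval catenoid_rad_gt0 catenoid_derivable catenoid_unit_speed.

Definition sphere_without_poles : profile :=
  Profile (fun s => 0 < s < PI) sin cos
    sphere_interval (fun s H => sin_gt_0 s (proj1 H) (proj2 H))
    sphere_derivable sphere_unit_speed.

Lemma on_sphere_without_poles (p : R3) :
  on_surface sphere_without_poles p <->
  dot p p = 1 /\ p <> (0, 0, 1) /\ p <> (0, 0, -1).
Proof.
destruct p as [[x y] z]; unfold on_surface, param_dom, param, dot; simpl.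
split.
- intros [[s f] [Hs E]]; simpl in *; injection E as Ex Ey Ez.
  pose proof (sin_gt_0 s (proj1 Hs) (proj2 Hs)).
  pose proof (sin2_cos2 s) as A; pose proof (sin2_cos2 f) as B.
  unfold Rsqr in A, B; repeat split.
  + subst; transitivity (sin s * sin s * (sin f * sin f + cos f * cos f)
                         + cos s * cos s); [ring | rewrite B; lra].
  + intro K; injection K as Kx Ky Kz; subst z; nra.
  + intro K; injection K as Kx Ky Kz; subst z; nra.
- intros [E [Hn Hs]].
  assert (Hz : -1 < z < 1).
  { assert (Hz : -1 <= z <= 1) by nra.
    destruct (Req_dec z 1) as [-> |]; [exfalso; apply Hn; replace x with 0 by nra; replace y with 0 by nra; reflexivity |].
    destruct (Req_dec z (-1)) as [-> |]; [exfalso; apply Hs; replace x with 0 by nra; replace y with 0 by nra; reflexivity |].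
    lra. }
  assert (Hr : 0 < x * x + y * y) by nra.
  set (r := sqrt (x * x + y * y)).
  assert (r0 : 0 < r) by (apply sqrt_lt_R0; exact Hr).
  assert (rr : r * r = x * x + y * y) by (apply sqrt_sqrt; lra).
  assert (Sz : sin (acos z) = r).
  { rewrite sin_acos by lra; unfold r; f_equal; unfold Rsqr; lra. }
  assert (Hx : -1 <= x / r <= 1).
  { split; apply (Rmult_le_reg_r r _ _ r0); unfold Rdiv;
    rewrite Rmult_assoc, Rinv_l by lra; nra. }
  assert (Sx : sin (acos (x / r)) = Rabs y / r).
  { rewrite sin_acos by lra.
    replace (1 - Rsqr (x / r)) with (Rsqr (y / r)).
    - rewrite sqrt_Rsqr_abs, Rabs_div, (Rabs_pos_eq r) by lra; reflexivity.
    - unfold Rsqr; apply (Rmult_eq_reg_r (r * r)); [| nra].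
      transitivity (y * y); [field; lra |].
      transitivity (r * r - x * x); [lra | field; lra]. }
  exists (acos z, if Rle_dec 0 y then acos (x / r) else - acos (x / r)); simpl.
  split; [apply acos_bound_lt; lra |].
  rewrite Sz, cos_acos by lra.
  destruct (Rle_dec 0 y) as [Hy | Hy].
  + rewrite cos_acos, Sx, Rabs_pos_eq by lra.
    f_equal; f_equal; field; lra.
  + rewrite cos_neg, sin_neg, cos_acos, Sx, Rabs_left by lra.
    f_equal; f_equal; field; lra.
Qed.

(* Main.v *)
Require Import Defs.
From Stdlib Require Import Reals Lra.
From Coquelicot Require Import Coquelicot.

Open Scope R_scope.

(** The frame [ds, (1/r) dphi] is parallel, so geodesics are the curves on which
    [s'] and [r phi'] are constant. The Gauss map of the catenoid is, up to sign,
    [(s, phi) |-> (theta, phi)] with [theta = PI/2 + atan s], hence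
    [sin theta = / r] and [d theta / ds = / r^2] where [r^2 = 1 + s^2]: it is
    conformal with factor [/ r^2] and maps meridians to meridians. A geodesic
    [s = a t + d], [r phi' = b] is therefore mapped to a curve with
    [theta' = a / r^2], [sin theta phi' = b / r^2], and the time change
    [dt/dx = r^2 = 1 + (a t + d)^2], solved by the tangent, makes both constant.
    Continuity and connectedness reduce an arbitrary Gauss map to this one up to
    a global sign. *)

(** * Induced metric and connection of a surface of revolution in the coordinates [(s, phi)] *)

Lemma sin2_cos2_pow (x : R) : sin x ^ 2 + cos x ^ 2 = 1.
Proof. rewrite <- (sin2_cos2 x); unfold Rsqr; ring. Qed.

Lemma partial3_s (M : profile) (u : R * R) :
  partial3 I1 (param M) u =
  (Derive (rad M) (fst u) * cos (snd u), Derive (rad M) (fst u) * sin (snd u),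
   Derive (hgt M) (fst u)).
Proof.
unfold partial3, partial, param; simpl; now rewrite !Derive_scal_l.
Qed.

Lemma partial3_phi (M : profile) (u : R * R) :
  partial3 I2 (param M) u =
  (- (rad M (fst u) * sin (snd u)), rad M (fst u) * cos (snd u), 0).
Proof.
unfold partial3, partial, param; simpl.
rewrite !Derive_scal, Derive_const.
rewrite (is_derive_unique _ _ _ (is_derive_cos _)), (is_derive_unique _ _ _ (is_derive_sin _)).
f_equal; f_equal; ring.
Qed.

Lemma induced_metric_sphi (M : profile) (u : R * R) :
  induced_metric M u I1 I2 = 0 /\ induced_metric M u I2 I1 = 0.
Proof.
unfold induced_metric; rewrite partial3_s, partial3_phi; unfold dot; simpl.
split; ring.
Qed.

Lemma induced_metric_phiphi (M : profile) (u : R * R) :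
  induced_metric M u I2 I2 = rad M (fst u) ^ 2.
Proof.
unfold induced_metric; rewrite partial3_phi; unfold dot; simpl.
pose proof (sin2_cos2_pow (snd u)); nra.
Qed.

Lemma induced_metric_ss (M : profile) (u : R * R) :
  param_dom M u -> induced_metric M u I1 I1 = 1.
Proof.
intros Hu; unfold induced_metric; rewrite partial3_s; unfold dot; simpl.
rewrite <- (profile_unit_speed M (fst u) Hu).
pose proof (sin2_cos2_pow (snd u)).
transitivity (Derive (rad M) (fst u) ^ 2 * (sin (snd u) ^ 2 + cos (snd u) ^ 2)
              + Derive (hgt M) (fst u) ^ 2); [ring | rewrite H; ring].
Qed.

Lemma locally_dom (M : profile) (s : R) : dom M s -> locally s (dom M).
Proof. intros Hs; exact (proj1 (dom_interval M) s Hs). Qed.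

Lemma partial_metric_ss (M : profile) (i : idx) (u : R * R) :
  param_dom M u -> partial i (fun w => induced_metric M w I1 I1) u = 0.
Proof.
intros Hu; destruct i; simpl.
(* Unit speed gives the value 1 on the domain only; the domain being open, this is enough to
   differentiate in [s]. *)
- rewrite (Derive_ext_loc _ (fun _ => 1)); [apply Derive_const |].
  apply (filter_imp (dom M)); [| exact (locally_dom M _ Hu)].
  intros x Hx; now apply induced_metric_ss.
- rewrite (Derive_ext _ (fun _ => 1)); [apply Derive_const |].
  intros y; now apply induced_metric_ss.
Qed.

Lemma partial_metric_sphi (M : profile) (i : idx) (u : R * R) :
  partial i (fun w => induced_metric M w I1 I2) u = 0 /\
  partial i (fun w => induced_metric M w I2 I1) u = 0.
Proof.
assert (Z : partial i (fun _ => 0) u = 0) by (destruct i; exact (Derive_const _ _)).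
split; (etransitivity; [apply partial_ext; intros w; apply induced_metric_sphi | exact Z]).
Qed.

Lemma partial_metric_phiphi (M : profile) (u : R * R) :
  param_dom M u ->
  partial I1 (fun w => induced_metric M w I2 I2) u
    = 2 * rad M (fst u) * Derive (rad M) (fst u) /\
  partial I2 (fun w => induced_metric M w I2 I2) u = 0.
Proof.
intros Hu; split.
- rewrite (partial_ext _ _ (fun w => rad M (fst w) ^ 2) _
             (induced_metric_phiphi M)); unfold partial.
  change (Derive (fun x => rad M x ^ 2) (fst u)
          = 2 * rad M (fst u) * Derive (rad M) (fst u)).
  rewrite (Derive_pow (rad M) 2); [simpl; ring |].
  apply (profile_derivable M _ Hu).
- rewrite (partial_ext _ _ (fun w => rad M (fst w) ^ 2) _
             (induced_metric_phiphi M)); simpl.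
  apply Derive_const.
Qed.

(** The second component is [(r phi')' / r], so the geodesic equation says that
    the velocity has constant components in the frame [ds, (1/r) dphi]. *)
Lemma vectorial_torsion_along_velocity (M : profile) (c : R -> R * R) (t : R) :
  param_dom M (c t) ->
  vectorial_torsion_along (induced_metric M) (torsion_field M) c
    (velocity c) t I1 = Derive (fun x => velocity c x I1) t /\
  vectorial_torsion_along (induced_metric M) (torsion_field M) c
    (velocity c) t I2 =
  Derive (fun x => velocity c x I2) t
  + Derive (rad M) (fst (c t)) / rad M (fst (c t))
    * velocity c t I1 * velocity c t I2.
Proof.
intros Hu.
pose proof (rad_gt0 M _ Hu) as Hr.
unfold vectorial_torsion_along, levi_civita_along, inner, christoffel, sum2,
  inv2, det2, torsion_field.
destruct (partial_metric_phiphi M (c t) Hu) as [P1 P2].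
destruct (induced_metric_sphi M (c t)) as [G12 G21].
rewrite P1, P2.
rewrite !(partial_metric_ss M _ _ Hu).
rewrite !(proj1 (partial_metric_sphi M _ (c t))).
rewrite !(proj2 (partial_metric_sphi M _ (c t))).
rewrite G12, G21, !induced_metric_phiphi, !(induced_metric_ss M _ Hu).
split; field; lra.
Qed.

(** * Unit normal and Gaussian curvature of a surface of revolution *)

(** By unit speed the cross product of the coordinate fields has length [r], so normalising it
    removes the factor [r] and leaves only [r'] and [h']. *)
Lemma unit_normalE (M : profile) (u : R * R) :
  param_dom M u ->
  unit_normal M u =
  (- (Derive (hgt M) (fst u) * cos (snd u)),
   - (Derive (hgt M) (fst u) * sin (snd u)), Derive (rad M) (fst u)).
Proof.
intros Hu; pose proof (rad_gt0 M _ Hu) as Hr.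
unfold unit_normal; cbv zeta; rewrite partial3_s, partial3_phi.
pose proof (sin2_cos2_pow (snd u)) as T.
unfold cross; simpl fst; simpl snd.
set (r := rad M (fst u)) in *; set (r' := Derive (rad M) (fst u)).
set (h' := Derive (hgt M) (fst u)).
assert (U : r' ^ 2 + h' ^ 2 = 1) by apply (profile_unit_speed M _ Hu).
match goal with |- scal3 (/ sqrt ?d) _ = _ => replace d with (r * r) end.
- rewrite sqrt_square by lra.
  unfold scal3; simpl.
  f_equal; [f_equal |]; [field; lra | field; lra |].
  transitivity (r' * (sin (snd u) ^ 2 + cos (snd u) ^ 2));
    [field; lra | rewrite T; ring].
- unfold dot; simpl.
  transitivity (r ^ 2 * (h' ^ 2 * (sin (snd u) ^ 2 + cos (snd u) ^ 2)
     + r' ^ 2 * (sin (snd u) ^ 2 + cos (snd u) ^ 2) ^ 2)); [|ring].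
  rewrite T; transitivity (r ^ 2 * (r' ^ 2 + h' ^ 2)); [rewrite U|]; ring.
Qed.

Lemma partial3_ext (i : idx) (X Y : R * R -> R3) (u : R * R) :
  (forall w, X w = Y w) -> partial3 i X u = partial3 i Y u.
Proof.
intros H; unfold partial3; f_equal; [f_equal |]; apply partial_ext; intros w;
now rewrite H.
Qed.

(** Product of the principal curvatures: [r' h'' - h' r''] is the curvature of the profile curve and
    [h' / r] that of the parallels. The second fundamental form is diagonal in [(s, phi)]. *)
Lemma gaussian_curvatureE (M : profile) (u : R * R) :
  param_dom M u ->
  let r' := Derive (rad M) in let h' := Derive (hgt M) in
  gaussian_curvature M u =
  h' (fst u) * (r' (fst u) * Derive h' (fst u) - h' (fst u) * Derive r' (fst u))
  / rad M (fst u).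
Proof.
intros Hu r' h'; pose proof (rad_gt0 M _ Hu) as Hr.
unfold gaussian_curvature, det2, second_form.
rewrite !(partial3_ext _ _ _ _ (partial3_s M)),
  !(partial3_ext _ _ _ _ (partial3_phi M)), (unit_normalE M u Hu).
destruct (induced_metric_sphi M u) as [G12 G21].
rewrite G12, G21, induced_metric_phiphi, (induced_metric_ss M u Hu).
unfold partial3, partial, dot; simpl.
rewrite ?Derive_opp, ?Derive_scal_l, ?Derive_scal, ?Derive_opp, ?Derive_const,
 ?Derive_scal_l, ?Derive_scal.
rewrite ?(is_derive_unique _ _ _ (is_derive_cos _)), ?(is_derive_unique _ _ _ (is_derive_sin _)).
fold r' h'.
pose proof (sin2_cos2_pow (snd u)) as T.
change (Derive (fun x : R => h' x)) with (Derive h').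
change (Derive (fun x : R => r' x)) with (Derive r').
set (x := sin (snd u)) in *; set (y := cos (snd u)) in *.
(* Sine and cosine are atoms for [field]; the even powers of the sine are eliminated by hand. *)
assert (E : x ^ 2 = 1 - y ^ 2) by lra.
assert (E4 : x ^ 4 = (1 - y ^ 2) ^ 2) by (rewrite <- E; ring).
field_simplify; [| lra | lra].
rewrite E4, E; field; lra.
Qed.

(** * Curvature of the sphere and of the catenoid *)

Lemma sphere_curvature (u : R * R) :
  param_dom sphere_without_poles u ->
  gaussian_curvature sphere_without_poles u = 1.
Proof.
intros Hu; rewrite gaussian_curvatureE by exact Hu; simpl.
pose proof (rad_gt0 _ _ Hu) as Hr; simpl in Hr.
assert (Ds : forall x, Derive sin x = cos x) by
  (intros; apply is_derive_unique, is_derive_sin).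
assert (Dc : forall x, Derive cos x = - sin x) by
  (intros; apply is_derive_unique, is_derive_cos).
rewrite (Derive_ext _ _ _ Ds), (Derive_ext _ _ _ Dc), Derive_opp, Ds, Dc.
pose proof (sin2_cos2_pow (fst u)).
apply (Rmult_eq_reg_r (sin (fst u))); [| lra].
field_simplify; [| lra].
transitivity (sin (fst u) * (sin (fst u) ^ 2 + cos (fst u) ^ 2));
  [ring | rewrite H; ring].
Qed.

Lemma sqrt1_gt0 (s : R) : 0 < sqrt (1 + s ^ 2).
Proof. apply sqrt_lt_R0; nra. Qed.

Lemma sqrt1_sq (s : R) : sqrt (1 + s ^ 2) ^ 2 = 1 + s ^ 2.
Proof. apply pow2_sqrt; nra. Qed.

Lemma Derive_sqrt1 (s : R) :
  Derive (fun x => sqrt (1 + x ^ 2)) s = s / sqrt (1 + s ^ 2).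
Proof. apply is_derive_unique, is_derive_sqrt1. Qed.

Lemma Derive_arcsinh (s : R) : Derive arcsinh s = / sqrt (1 + s ^ 2).
Proof. apply is_derive_unique, is_derive_arcsinh. Qed.

Lemma catenoid_curvature (u : R * R) :
  gaussian_curvature catenoid u = - / (1 + fst u ^ 2) ^ 2.
Proof.
rewrite gaussian_curvatureE by exact I; simpl rad; simpl hgt.
rewrite (Derive_ext _ _ _ Derive_sqrt1), (Derive_ext _ _ _ Derive_arcsinh).
rewrite Derive_sqrt1, Derive_arcsinh.
set (s := fst u); change (s * (s * 1)) with (s ^ 2).
pose proof (sqrt1_gt0 s) as Hr.
assert (Hi : is_derive (fun x : R => / sqrt (1 + x ^ 2)) s
               (- (s / sqrt (1 + s ^ 2)) / sqrt (1 + s ^ 2) ^ 2)).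
{ apply (is_derive_inv (fun x => sqrt (1 + x ^ 2))); [apply is_derive_sqrt1 | lra]. }
rewrite (is_derive_unique _ _ _ Hi).
assert (Hq : is_derive (fun x : R => x / sqrt (1 + x ^ 2)) s
   (1 * / sqrt (1 + s ^ 2)
    + s * (- (s / sqrt (1 + s ^ 2)) / sqrt (1 + s ^ 2) ^ 2))).
{ apply (is_derive_mult (fun x => x) (fun x => / sqrt (1 + x ^ 2)));
   [apply @is_derive_id | exact Hi | intros; apply Rmult_comm]. }
rewrite (is_derive_unique _ _ _ Hq).
pose proof (sqrt1_sq s) as E.
set (r := sqrt (1 + s ^ 2)) in *; rewrite <- E; field; lra.
Qed.

(** The curvature is -1 on the waist [s = 0] and -1/4 on the parallel [s = 1]. *)
Lemma catenoid_curvature_not_constant : ~ constant_curvature catenoid.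
Proof.
intros [k Hk].
pose proof (Hk (0, 0) I) as H0; pose proof (Hk (1, 0) I) as H1.
rewrite catenoid_curvature in H0, H1; simpl in H0, H1; lra.
Qed.

(** * Geodesics as curves with constant velocity components in the parallel frame *)

(** Mean value theorem on the segment between the two times, which stays in [I]. It turns local
    conservation laws into constants valid along the whole geodesic. *)
Lemma constant_on_interval (I : R -> Prop) (f : R -> R) (t1 t : R) :
  is_open_interval I -> (forall x, I x -> is_derive f x 0) ->
  I t1 -> I t -> f t = f t1.
Proof.
intros [_ Hc] Hf H1 Ht.
assert (HI : forall x, Rmin t1 t <= x <= Rmax t1 t -> I x).
{ intros x Hx; destruct (Rle_dec t1 t).
  - rewrite Rmin_left, Rmax_right in Hx by lra; now apply (Hc t1 x t).
  - rewrite Rmin_right, Rmax_left in Hx by lra; now apply (Hc t x t1). }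
destruct (MVT_gen f t1 t (fun _ => 0)) as [c [_ E]].
- intros x Hx; apply Hf, HI; lra.
- intros x Hx; apply continuity_pt_filterlim.
  apply (ex_derive_continuous f); exists 0; apply Hf, HI, Hx.
- lra.
Qed.

(** With [v = s'] and [w = phi'], the geodesic equation reads [v' = 0] and [w' + (r' / r) v w = 0];
    multiplied by [r], the second is [(r w)' = 0]. The result is local because the coordinates are
    chosen near each time. *)
Lemma geodesic_first_integrals (M : profile) (I : R -> Prop) (gamma : R -> R3)
    (t0 : R) :
  geodesic M I gamma -> I t0 ->
  exists s phi v w : R -> R, locally t0 (fun t =>
    dom M (s t) /\ param M (s t, phi t) = gamma t /\
    is_derive s t (v t) /\ is_derive phi t (w t) /\
    is_derive v t 0 /\ is_derive (fun x => rad M (s x) * w x) t 0).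
Proof.
intros [_ Hg] H0; destruct (Hg t0 H0) as [c Hc].
exists (fun t => fst (c t)), (fun t => snd (c t)),
  (fun t => velocity c t I1), (fun t => velocity c t I2).
apply (filter_imp _ _) with (2 := Hc).
intros t [Hd [Hp Hk]].
destruct (Hk I1) as [D1 [D1' E1]], (Hk I2) as [D2 [D2' E2]].
destruct (vectorial_torsion_along_velocity M c t Hd) as [V1 V2].
rewrite V1 in E1; rewrite V2 in E2; clear V1 V2 Hk.
apply Derive_correct in D1, D2.
assert (D1'' : is_derive (fun x => velocity c x I1) t 0)
  by (rewrite <- E1; now apply Derive_correct).
pose proof (rad_gt0 M _ Hd) as Hr.
split; [exact Hd |]; split; [now rewrite <- surjective_pairing |].
split; [exact D1 |]; split; [exact D2 |]; split; [exact D1'' |].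
destruct (profile_derivable M _ Hd) as [Dr _]; apply Derive_correct in Dr.
pose proof (is_derive_comp (rad M) (fun x => fst (c x)) t _ _ Dr D1) as Drs.
assert (D2'' : is_derive (fun x => velocity c x I2) t
  (- (Derive (rad M) (fst (c t)) / rad M (fst (c t))
      * velocity c t I1 * velocity c t I2))).
{ replace (- _) with (Derive (fun x => velocity c x I2) t) by lra.
  now apply Derive_correct. }
replace 0 with (velocity c t I1 * Derive (rad M) (fst (c t)) * velocity c t I2
  + rad M (fst (c t)) * - (Derive (rad M) (fst (c t)) / rad M (fst (c t))
      * velocity c t I1 * velocity c t I2)) by (field; lra).
exact (is_derive_mult _ _ t _ _ Drs D2'' Rmult_comm).
Qed.

(** [a] and [b] are the components of the velocity in the parallel frame
    [ds, (1/r) dphi]. *)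
Definition loxodrome_at (M : profile) (gamma : R -> R3) (a b t0 : R) : Prop :=
  exists s phi : R -> R, locally t0 (fun t =>
    dom M (s t) /\ param M (s t, phi t) = gamma t /\
    is_derive s t a /\ is_derive phi t (b / rad M (s t))).

(** Converse of the first integrals: [phi' = b / r] differentiates to [- b r' a / r^2], which
    cancels the connection term [(r' / r) s' phi']. *)
Lemma loxodrome_geodesic (M : profile) (I : R -> Prop) (gamma : R -> R3)
    (a b : R) :
  (exists t1 t2, I t1 /\ I t2 /\ gamma t1 <> gamma t2) ->
  (forall t0, I t0 -> loxodrome_at M gamma a b t0) ->
  geodesic M I gamma.
Proof.
intros Hn Hl; split; [exact Hn |].
intros t0 H0; destruct (Hl t0 H0) as [s [phi Hs]].
exists (fun t => (s t, phi t)).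
(* The velocity has to be differentiated once more, so its explicit form is needed on a
   neighbourhood of each nearby time. *)
apply locally_locally in Hs.
apply (filter_imp _ _) with (2 := Hs); clear Hs.
intros t Hs.
destruct (locally_singleton _ _ Hs) as [Hd [Hp [D1 D2]]].
pose (c := fun x => (s x, phi x)); fold c.
pose proof (rad_gt0 M _ Hd) as Hr.
assert (D1' : is_derive (fun x => velocity c x I1) t 0).
{ apply (is_derive_ext_loc (fun _ => a)); [| apply @is_derive_const].
  apply (filter_imp _ _) with (2 := Hs); intros x [_ [_ [D _]]].
  symmetry; now apply is_derive_unique. }
assert (D2' : is_derive (fun x : R => velocity c x I2) t
   (- (b * Derive (rad M) (s t) * a) / rad M (s t) ^ 2)).
{ apply (is_derive_ext_loc (fun x => b * / rad M (s x))).
  - apply (filter_imp _ _) with (2 := Hs); intros x [_ [_ [_ D]]].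
    symmetry; now apply is_derive_unique.
  - destruct (profile_derivable M _ Hd) as [Dr _]; apply Derive_correct in Dr.
    pose proof (is_derive_comp (rad M) s t _ _ Dr D1) as Drs.
    apply is_derive_inv in Drs; [| lra].
    apply (is_derive_scal _ _ b) in Drs.
    eapply eq_rect; [exact Drs |].
    unfold scal; simpl; unfold mult; simpl; field; lra. }
split; [exact Hd |]; split; [exact Hp |].
destruct (vectorial_torsion_along_velocity M c t Hd) as [V1 V2].
intros [|].
- split; [exists a; exact D1 |]; split; [exists 0; exact D1' |].
  rewrite V1; now apply is_derive_unique.
- split; [eexists; exact D2 |]; split; [eexists; exact D2' |].
  rewrite V2, (is_derive_unique _ _ _ D2').
  change (velocity c t I1) with (Derive s t).
  change (velocity c t I2) with (Derive phi t).
  rewrite (is_derive_unique _ _ _ D1), (is_derive_unique _ _ _ D2).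
  simpl; field; lra.
Qed.

(** Charts at different times are unrelated, so the first integrals could a priori have different
    constants. They are therefore expressed through [gamma] alone, as functions defined on all of
    [I], and only the angle [phi] remains local. *)
Lemma catenoid_geodesic (I : R -> Prop) (gamma : R -> R3) :
  is_open_interval I -> geodesic catenoid I gamma ->
  exists a b d : R, forall t0, I t0 -> exists phi : R -> R,
    locally t0 (fun t => param catenoid (a * t + d, phi t) = gamma t /\
      is_derive phi t (b / sqrt (1 + (a * t + d) ^ 2))).
Proof.
intros HI Hg.
(* The height of the catenoid is [arcsinh s], so [S] is [s]. Since [x y' - y x' = r^2 phi'],
   dividing by [r] makes [W] equal to [r phi'], whatever the choice of angle. *)
pose (S := fun t => sinh (snd (gamma t))).
pose (W := fun t => (fst (fst (gamma t)) * Derive (fun x => snd (fst (gamma x))) t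
   - snd (fst (gamma t)) * Derive (fun x => fst (fst (gamma x))) t)
   / sqrt (1 + S t ^ 2)).
assert (Hloc : forall t0, I t0 -> exists s phi v w : R -> R, locally t0 (fun t =>
    param catenoid (s t, phi t) = gamma t /\ S t = s t /\
    is_derive S t (v t) /\ is_derive phi t (w t) /\ is_derive v t 0 /\
    W t = sqrt (1 + s t ^ 2) * w t /\
    is_derive (fun x => sqrt (1 + s x ^ 2) * w x) t 0)).
{ intros t0 H0.
  destruct (geodesic_first_integrals _ _ _ t0 Hg H0) as [s [phi [v [w Hs]]]].
  exists s, phi, v, w.
  apply locally_locally in Hs.
  apply (filter_imp _ _) with (2 := Hs); clear Hs; intros t Hs.
  destruct (locally_singleton _ _ Hs) as [_ [Hp [D1 [D2 [D1' D2']]]]].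
  assert (ES : forall x, param catenoid (s x, phi x) = gamma x -> S x = s x).
  { intros x Hx; unfold S; rewrite <- Hx; simpl; apply sinh_arcsinh. }
  split; [exact Hp |]; split; [now apply ES |].
  split.
  { apply (is_derive_ext_loc s); [| exact D1].
    apply (filter_imp _ _) with (2 := Hs); intros x [_ [Hx _]].
    symmetry; now apply ES. }
  split; [exact D2 |]; split; [exact D1' |]; split; [| exact D2'].
  assert (Dr : is_derive (fun x => sqrt (1 + s x ^ 2)) t
            (v t * (s t / sqrt (1 + s t ^ 2)))).
  { exact (is_derive_comp (fun x => sqrt (1 + x ^ 2)) s t _ _
      (is_derive_sqrt1 (s t)) D1). }
  assert (Dx : Derive (fun x => fst (fst (gamma x))) t =
     v t * (s t / sqrt (1 + s t ^ 2)) * cos (phi t)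
     + sqrt (1 + s t ^ 2) * (w t * - sin (phi t))).
  { apply is_derive_unique.
    apply (is_derive_ext_loc (fun x => sqrt (1 + s x ^ 2) * cos (phi x))).
    - apply (filter_imp _ _) with (2 := Hs); intros x [_ [Hx _]].
      now rewrite <- Hx.
    - apply (is_derive_mult (fun x => sqrt (1 + s x ^ 2)) (fun x => cos (phi x)));
        [exact Dr | | exact Rmult_comm].
      exact (is_derive_comp cos phi t _ _ (is_derive_cos _) D2). }
  assert (Dy : Derive (fun x => snd (fst (gamma x))) t =
     v t * (s t / sqrt (1 + s t ^ 2)) * sin (phi t)
     + sqrt (1 + s t ^ 2) * (w t * cos (phi t))).
  { apply is_derive_unique.
    apply (is_derive_ext_loc (fun x => sqrt (1 + s x ^ 2) * sin (phi x))).
    - apply (filter_imp _ _) with (2 := Hs); intros x [_ [Hx _]].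
      now rewrite <- Hx.
    - apply (is_derive_mult (fun x => sqrt (1 + s x ^ 2)) (fun x => sin (phi x)));
        [exact Dr | | exact Rmult_comm].
      exact (is_derive_comp sin phi t _ _ (is_derive_sin _) D2). }
  unfold W; rewrite Dx, Dy, (ES _ Hp), <- Hp.
  unfold param; cbn [fst snd rad hgt catenoid].
  pose proof (sqrt1_gt0 (s t)); pose proof (sin2_cos2_pow (phi t)) as T.
  transitivity (sqrt (1 + s t ^ 2) * w t * (sin (phi t) ^ 2 + cos (phi t) ^ 2));
    [field; lra | rewrite T; ring]. }
(* Non-constancy of [gamma] supplies a time in [I] at which the constants are read off. *)
destruct (proj1 Hg) as [t1 [_ [H1 _]]].
pose (a := Derive S t1).
assert (Ea : forall t, I t -> Derive S t = a).
{ intros t Ht; apply (constant_on_interval I); trivial.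
  intros x Hx; destruct (Hloc x Hx) as [s [phi [v [w Hs]]]].
  apply (is_derive_ext_loc v); [| apply (locally_singleton _ _ Hs)].
  apply (filter_imp _ _) with (2 := Hs); intros y Hy.
  symmetry; apply is_derive_unique, Hy. }
pose (d := S t1 - a * t1).
assert (Ed : forall t, I t -> S t = a * t + d).
{ intros t Ht.
  enough (E : S t - a * t = d) by lra.
  apply (constant_on_interval I (fun t => S t - a * t)); trivial.
  intros x Hx; destruct (Hloc x Hx) as [s [phi [v [w Hs]]]].
  destruct (locally_singleton _ _ Hs) as [_ [_ [DS _]]].
  assert (DS' : is_derive S x a).
  { rewrite <- (Ea x Hx); apply Derive_correct; eexists; exact DS. }
  auto_derive; [eexists; exact DS' |].
  change (Derive (fun x => S x) x) with (Derive S x).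
  rewrite (Ea x Hx); ring. }
assert (Eb : forall t, I t -> W t = W t1).
{ intros t Ht; apply (constant_on_interval I); trivial.
  intros x Hx; destruct (Hloc x Hx) as [s [phi [v [w Hs]]]].
  apply (is_derive_ext_loc (fun x => sqrt (1 + s x ^ 2) * w x));
    [| apply (locally_singleton _ _ Hs)].
  apply (filter_imp _ _) with (2 := Hs); intros y Hy.
  symmetry; apply Hy. }
exists a, (W t1), d; intros t0 H0.
destruct (Hloc t0 H0) as [s [phi [v [w Hs]]]]; exists phi.
pose proof (filter_and _ _ (proj1 HI t0 H0) Hs) as Hs'.
apply (filter_imp _ _) with (2 := Hs').
intros t [Ht [Hp [ES [_ [Dphi [_ [EW _]]]]]]].
rewrite <- (Ed t Ht), ES; split; [exact Hp |].
replace (W t1 / sqrt (1 + s t ^ 2)) with (w t); [exact Dphi |].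
rewrite <- (Eb t Ht), EW; field; pose proof (sqrt1_gt0 (s t)); lra.
Qed.

(** * The change of time *)

(** Serves to show that the preimage of an interval under the time change is an interval. *)
Lemma increasing_of_derive_gt0 (D : R -> Prop) (f df : R -> R) (x y : R) :
  is_open_interval D -> (forall x, D x -> is_derive f x (df x)) ->
  (forall x, D x -> 0 < df x) -> D x -> D y -> x <= y -> f x <= f y.
Proof.
intros [_ Hc] Hf Hp Hx Hy Hxy.
assert (HD : forall z, x <= z <= y -> D z) by (intros z Hz; now apply (Hc x z y)).
destruct (MVT_gen f x y df) as [c [Hc' E]];
  rewrite ?Rmin_left, ?Rmax_right in * by lra.
- intros z Hz; apply Hf, HD; lra.
- intros z Hz; apply continuity_pt_filterlim.
  apply (ex_derive_continuous f); exists (df z); apply Hf, HD, Hz.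
- pose proof (Hp c (HD c Hc')); nra.
Qed.

(** Solves [psi' = r^2] along the catenoid geodesic [s = a t + d]; the Gauss map
    scales lengths by [1 / r^2]. *)
Lemma quadratic_time_change (a d : R) :
  exists (D : R -> Prop) (psi : R -> R), is_open_interval D /\
    (forall x, D x -> is_derive psi x (1 + (a * psi x + d) ^ 2)) /\
    (forall t, exists x, D x /\ psi x = t).
Proof.
destruct (Req_dec a 0) as [-> | Ha].
- exists (fun _ => True), (fun x => (1 + d ^ 2) * x).
  split; [exact line_interval |]; split.
  + intros x _; auto_derive; [trivial | ring].
  + intros t; exists (t / (1 + d ^ 2)); split; [trivial | field; nra].
(* For [u = a psi + d] the equation becomes [u' = a (1 + u^2)], solved by [u = tan (a x)]; one
   branch of the tangent already takes every real value. *)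
- exists (fun x => - PI / 2 < a * x < PI / 2), (fun x => (tan (a * x) - d) / a).
  split; [split |split].
  + apply (open_comp (fun x => a * x) (fun y => - PI / 2 < y < PI / 2)).
    * intros x _; apply (ex_derive_continuous (fun x => a * x)); auto_derive; trivial.
    * apply open_and; [apply open_gt | apply open_lt].
  + intros x y z Hx Hz Hy; destruct (Rlt_dec 0 a); nra.
  + intros x Hx.
    assert (Hc : cos (a * x) <> 0) by (apply Rgt_not_eq, cos_gt_0; lra).
    assert (Dt : is_derive (fun x => tan (a * x)) x (a * (tan (a * x) ^ 2 + 1))).
    { apply (is_derive_comp tan (fun x => a * x)); [now apply is_derive_tan |].
      auto_derive; [trivial | ring]. }
    replace (1 + _) with (/ a * (a * (tan (a * x) ^ 2 + 1) - 0)) by (field; exact Ha).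
    apply (is_derive_ext (fun x => / a * (tan (a * x) - d)));
      [intros; unfold Rdiv; apply Rmult_comm |].
    apply is_derive_scal, (is_derive_minus (fun x => tan (a * x)) (fun _ => d));
      [exact Dt | apply @is_derive_const].
  + intros t; exists (atan (a * t + d) / a).
    replace (a * (atan (a * t + d) / a)) with (atan (a * t + d)) by (field; exact Ha).
    split; [apply atan_bound | rewrite tan_atan; field; exact Ha].
Qed.

(** * The Gauss map of the catenoid: injectivity, uniqueness up to sign, existence *)

Lemma unit_normal_catenoid (u : R * R) :
  unit_normal catenoid u =
  (- (/ sqrt (1 + fst u ^ 2) * cos (snd u)),
   - (/ sqrt (1 + fst u ^ 2) * sin (snd u)), fst u / sqrt (1 + fst u ^ 2)).
Proof.
rewrite unit_normalE by exact Logic.I; unfold rad, hgt, catenoid.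
now rewrite Derive_sqrt1, Derive_arcsinh.
Qed.

(** Keeps the image of a geodesic non-constant. The last coordinate [s / r] determines [r] through
    [(s / r)^2 = 1 - / r^2], hence [s]; the other two then determine the cosine and sine of the
    angle. *)
Lemma unit_normal_catenoid_inj (u v : R * R) :
  unit_normal catenoid u = unit_normal catenoid v ->
  param catenoid u = param catenoid v.
Proof.
rewrite !unit_normal_catenoid; unfold param; change (rad catenoid) with (fun s => sqrt (1 + s ^ 2)); cbv beta.
set (s := fst u); set (t := fst v).
pose proof (sqrt1_gt0 s) as Hs; pose proof (sqrt1_gt0 t) as Ht.
pose proof (sqrt1_sq s) as Es; pose proof (sqrt1_sq t) as Et.
intros E; apply pair_equal_spec in E; destruct E as [E Ez].
apply pair_equal_spec in E; destruct E as [Ex Ey].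
assert (Er : sqrt (1 + s ^ 2) = sqrt (1 + t ^ 2)).
{ assert (Q : forall x, (x / sqrt (1 + x ^ 2)) ^ 2 = 1 - / (1 + x ^ 2)).
  { intros x; unfold Rdiv; rewrite Rpow_mult_distr, pow_inv, sqrt1_sq; field; nra. }
  pose proof (Q s) as Qs; rewrite Ez, (Q t) in Qs.
  f_equal; apply Rinv_eq_reg; lra. }
rewrite Er in *.
assert (Est : s = t).
{ apply (Rmult_eq_reg_r (/ sqrt (1 + t ^ 2))); [exact Ez |].
  apply Rinv_neq_0_compat; lra. }
assert (Hi : / sqrt (1 + t ^ 2) <> 0) by (apply Rinv_neq_0_compat; lra).
apply Ropp_eq_compat in Ex, Ey; rewrite !Ropp_involutive in Ex, Ey.
apply Rmult_eq_reg_l in Ex; [| exact Hi].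
apply Rmult_eq_reg_l in Ey; [| exact Hi].
now rewrite Ex, Ey, Est.
Qed.

(** Orthogonality to the parallel puts [p] in the meridian plane, with radial component [q]. There
    [(q, z)] is a unit vector orthogonal to the unit vector [(r', h')], so it is [e] times
    [(- h', r')] with [e^2 = 1]. *)
Lemma unit_orthogonal_normal (M : profile) (u : R * R) (p : R3) :
  param_dom M u -> dot p p = 1 ->
  (forall i, dot p (partial3 i (param M) u) = 0) ->
  p = unit_normal M u \/ p = scal3 (-1) (unit_normal M u).
Proof.
intros Hu Hp Ho.
pose proof (Ho I1) as Hs; pose proof (Ho I2) as Hphi; clear Ho.
rewrite partial3_s in Hs; rewrite partial3_phi in Hphi.
rewrite unit_normalE by exact Hu.
pose proof (rad_gt0 M _ Hu) as Hr.
pose proof (profile_unit_speed M _ Hu) as U.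
pose proof (sin2_cos2_pow (snd u)) as T.
destruct p as [[x y] z]; unfold dot, scal3 in *; cbn [fst snd] in *.
set (r' := Derive (rad M) (fst u)) in *.
set (h' := Derive (hgt M) (fst u)) in *.
set (s := sin (snd u)) in *; set (c := cos (snd u)) in *.
assert (Hxy : y * c - x * s = 0).
{ apply (Rmult_eq_reg_l (rad M (fst u))); lra. }
set (q := x * c + y * s).
assert (Ex : x = q * c).
{ unfold q; transitivity (x * (s ^ 2 + c ^ 2) + s * (y * c - x * s));
  [rewrite T, Hxy |]; ring. }
assert (Ey : y = q * s).
{ unfold q; transitivity (y * (s ^ 2 + c ^ 2) - c * (y * c - x * s));
  [rewrite T, Hxy |]; ring. }
assert (Hq : q * r' + z * h' = 0) by (unfold q; lra).
assert (Hqz : q ^ 2 + z ^ 2 = 1).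
{ rewrite <- Hp, Ex, Ey; transitivity (q ^ 2 * (s ^ 2 + c ^ 2) + z ^ 2);
  [rewrite T |]; ring. }
set (e := z * r' - q * h').
assert (Eq : q = - (e * h')).
{ unfold e; transitivity (q * (r' ^ 2 + h' ^ 2) - r' * (q * r' + z * h'));
  [rewrite U, Hq |]; ring. }
assert (Ez : z = e * r').
{ unfold e; transitivity (z * (r' ^ 2 + h' ^ 2) - h' * (q * r' + z * h'));
  [rewrite U, Hq |]; ring. }
assert (He : e ^ 2 = 1).
{ rewrite Eq, Ez in Hqz.
  transitivity (e ^ 2 * (r' ^ 2 + h' ^ 2)); [rewrite U; ring |].
  rewrite <- Hqz; ring. }
assert (He' : e = 1 \/ e = -1).
{ destruct (Req_dec e 1); [now left | right].
  apply (Rmult_eq_reg_l (e - 1)); [| lra].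
  transitivity (e ^ 2 - e); [ring | rewrite He; ring]. }
clearbody q e; subst x y z q.
destruct He' as [-> | ->]; [left | right]; apply pair_equal_spec; (split; [apply pair_equal_spec; split |]); ring.
Qed.

Lemma continuous_R3 (T : UniformSpace) (f : T -> R3) (x : T) :
  continuous (fun t => fst (fst (f t))) x ->
  continuous (fun t => snd (fst (f t))) x ->
  continuous (fun t => snd (f t)) x -> continuous f x.
Proof.
intros H1 H2 H3.
assert (Hpair : forall (U V : UniformSpace) (g : T -> U) (h : T -> V),
  continuous g x -> continuous h x -> continuous (fun t => (g t, h t)) x).
{ intros U V g h Hg Hh; apply (continuous_comp_2 g h pair); trivial.
  apply (continuous_ext (fun p => p)); [intros []; reflexivity |].
  apply continuous_id. }
apply (continuous_ext (fun t => (fst (fst (f t)), snd (fst (f t)), snd (f t)))).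
{ intros t; now rewrite <- !surjective_pairing. }
now apply Hpair; [apply Hpair |].
Qed.

(** All values of [f] lie in [D], so continuity of [N] relative to [D] becomes plain continuity
    after composition. This lets a Gauss map be followed along a path on the surface. *)
Lemma continuous_on_comp (T U V : UniformSpace) (D : U -> Prop) (f : T -> U)
    (N : U -> V) (x : T) :
  (forall t, D (f t)) -> continuous f x -> continuous_on D N ->
  continuous (fun t => N (f t)) x.
Proof.
intros HD Hf HN P HP.
pose proof (HN (f x) (HD x) P HP) as HQ.
change (locally x (fun t => P (N (f t)))).
apply (filter_imp (fun t => D (f t) -> P (N (f t)))); [| exact (Hf _ HQ)].
intros t Ht; now apply Ht.
Qed.

(** At each point the normal is determined up to sign. If both signs occurred, the continuous
    function [F] below would change sign along a segment of the parameter plane, hence vanish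
    somewhere, whereas its values are [sqrt (1 + s^2)] up to sign. *)
Lemma gauss_map_catenoid_sign (N : R3 -> R3) :
  gauss_map catenoid N ->
  exists e : R, (e = 1 \/ e = -1) /\
    forall u, N (param catenoid u) = scal3 e (unit_normal catenoid u).
Proof.
intros [Hc [Hn Ho]].
assert (Hpm : forall u, N (param catenoid u) = scal3 1 (unit_normal catenoid u) \/
  N (param catenoid u) = scal3 (-1) (unit_normal catenoid u)).
{ intros u.
  destruct (unit_orthogonal_normal catenoid u (N (param catenoid u)) Logic.I)
    as [E | E].
  - apply Hn; exists u; split; [exact Logic.I | reflexivity].
  - intros i; now apply Ho.
  - left; rewrite E; destruct (unit_normal catenoid u) as [[x y] z].
    unfold scal3; simpl; now rewrite !Rmult_1_l.
  - now right. }
(* [sqrt (1 + s^2)] times the sign of [N] relative to [unit_normal] *)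
pose (F := fun u : R * R => let n := N (param catenoid u) in
  snd n * fst u - fst (fst n) * cos (snd u) - snd (fst n) * sin (snd u)).
assert (HF : forall e u, N (param catenoid u) = scal3 e (unit_normal catenoid u) ->
  F u = e * sqrt (1 + fst u ^ 2)).
{ intros e u E; unfold F; cbv zeta; rewrite E, unit_normal_catenoid.
  unfold scal3; cbn [fst snd].
  pose proof (sqrt1_gt0 (fst u)) as H; pose proof (sqrt1_sq (fst u)) as H2.
  pose proof (sin2_cos2_pow (snd u)) as T.
  set (r := sqrt (1 + fst u ^ 2)) in *.
  transitivity (e * (fst u ^ 2 + (sin (snd u) ^ 2 + cos (snd u) ^ 2)) / r);
    [field; lra |].
  rewrite T, Rplus_comm, <- H2; field; lra. }
assert (Hsame : forall u v, 0 < F u -> F v < 0 -> False).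
{ intros u v Hu Hv.
  pose (l := fun t => (fst u + t * (fst v - fst u), snd u + t * (snd v - snd u))).
  assert (C1 : forall t, continuous (fun x => fst (l x)) t).
  { intros t; apply (ex_derive_continuous (fun x => fst (l x))); unfold l; simpl.
    auto_derive; trivial. }
  assert (C2 : forall t, continuous (fun x => snd (l x)) t).
  { intros t; apply (ex_derive_continuous (fun x => snd (l x))); unfold l; simpl.
    auto_derive; trivial. }
  assert (Ccos : forall t, continuous (fun x => cos (snd (l x))) t).
  { intros t; apply (continuous_comp _ cos); [apply C2 | apply continuous_cos]. }
  assert (Csin : forall t, continuous (fun x => sin (snd (l x))) t).
  { intros t; apply (continuous_comp _ sin); [apply C2 | apply continuous_sin]. }
  assert (Cp : forall t, continuous (fun x => param catenoid (l x)) t).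
  { intros t.
    assert (Cr : continuous (fun x => sqrt (1 + fst (l x) ^ 2)) t).
    { apply (continuous_comp _ (fun s => sqrt (1 + s ^ 2))); [apply C1 |].
      apply (ex_derive_continuous (fun s => sqrt (1 + s ^ 2))).
      eexists; apply is_derive_sqrt1. }
    apply continuous_R3; unfold param; cbn [fst snd rad hgt catenoid].
    - apply (continuous_mult (fun x => sqrt (1 + fst (l x) ^ 2))); trivial.
    - apply (continuous_mult (fun x => sqrt (1 + fst (l x) ^ 2))); trivial.
    - apply (continuous_comp _ arcsinh); [apply C1 |].
      apply (ex_derive_continuous arcsinh); eexists; apply is_derive_arcsinh. }
  assert (CN : forall t, continuous (fun x => N (param catenoid (l x))) t).
  { intros t; apply (continuous_on_comp _ _ _ (on_surface catenoid)); trivial.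
    intros x; exists (l x); split; [exact Logic.I | reflexivity]. }
  assert (CF : continuity (fun t => F (l t))).
  { intros t; apply continuity_pt_filterlim; unfold F; cbv zeta.
    assert (CN1 : continuous (fun x => fst (N (param catenoid (l x)))) t)
      by (apply (continuous_comp _ fst); [apply CN | apply continuous_fst]).
    assert (Cmul : forall f g : R -> R, continuous f t -> continuous g t ->
      continuous (fun x => f x * g x) t) by (intros; now apply @continuous_mult).
    assert (Csub : forall f g : R -> R, continuous f t -> continuous g t ->
      continuous (fun x => f x - g x) t) by (intros; now apply @continuous_minus).
    apply Csub; [apply Csub |]; apply Cmul; trivial.
    - apply (continuous_comp _ snd); [apply CN | apply continuous_snd].
    - apply (continuous_comp _ fst); [apply CN1 | apply continuous_fst].
    - apply (continuous_comp _ snd); [apply CN1 | apply continuous_snd]. }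
  assert (E0 : l 0 = u) by (unfold l; destruct u; simpl; f_equal; ring).
  assert (E1 : l 1 = v) by (unfold l; destruct u, v; simpl; f_equal; ring).
  destruct (IVT_gen _ 0 1 0 CF) as [t [_ Ht]].
  { rewrite E0, E1, Rmin_right, Rmax_left by lra; lra. }
  pose proof (sqrt1_gt0 (fst (l t))).
  destruct (Hpm (l t)) as [E | E]; apply HF in E; lra. }
assert (Hs : forall u : R * R, 0 < sqrt (1 + fst u ^ 2)) by (intros; apply sqrt1_gt0).
destruct (Hpm (0, 0)) as [E | E]; pose proof (HF _ _ E) as F0;
  pose proof (Hs (0, 0)) as H0.
- exists 1; split; [now left |]; intros u.
  destruct (Hpm u) as [Eu | Eu]; [exact Eu | exfalso].
  pose proof (HF _ _ Eu); pose proof (Hs u).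
  apply (Hsame (0, 0) u); lra.
- exists (-1); split; [now right |]; intros u.
  destruct (Hpm u) as [Eu | Eu]; [exfalso | exact Eu].
  pose proof (HF _ _ Eu); pose proof (Hs u).
  apply (Hsame u (0, 0)); lra.
Qed.

(** The normal is rewritten as a function of the point itself, by [s = sinh z] and
    [cos phi / r = x / r^2], [sin phi / r = y / r^2]. The formula is continuous on the whole space
    and involves no choice of angle. *)
Lemma gauss_map_catenoid_exists : exists N : R3 -> R3, gauss_map catenoid N.
Proof.
pose (N := fun p : R3 => let s := sinh (snd p) in
  (- (/ (1 + s ^ 2) * fst (fst p)), - (/ (1 + s ^ 2) * snd (fst p)),
   s / sqrt (1 + s ^ 2))).
assert (HN : forall u, N (param catenoid u) = unit_normal catenoid u).
{ intros u; rewrite unit_normal_catenoid; unfold N, param; cbv zeta.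
  cbn [fst snd rad hgt catenoid]; rewrite sinh_arcsinh.
  pose proof (sqrt1_gt0 (fst u)); pose proof (sqrt1_sq (fst u)) as E.
  set (r := sqrt (1 + fst u ^ 2)) in *; rewrite <- E.
  f_equal; f_equal; field; lra. }
exists N; split; [| split].
- apply continuous_on_forall; intros p _.
  assert (Cg : forall g : R -> R, (forall x, ex_derive g x) ->
     continuous (fun q : R3 => g (snd q)) p).
  { intros g Hg; apply (continuous_comp snd g); [apply continuous_snd |].
    apply (ex_derive_continuous g), Hg. }
  assert (Cinv : continuous (fun q : R3 => / (1 + sinh (snd q) ^ 2)) p).
  { apply (Cg (fun x => / (1 + sinh x ^ 2))); intros x.
    auto_derive; nra. }
  assert (C1 : continuous (fun q : R3 => fst q) p) by apply continuous_fst.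
  apply continuous_R3; unfold N; cbv zeta; cbn [fst snd].
  + apply (continuous_opp (fun q : R3 => / (1 + sinh (snd q) ^ 2) * fst (fst q))).
    apply (continuous_mult (fun q : R3 => / (1 + sinh (snd q) ^ 2))); [exact Cinv |].
    apply (continuous_comp fst fst); [exact C1 | apply continuous_fst].
  + apply (continuous_opp (fun q : R3 => / (1 + sinh (snd q) ^ 2) * snd (fst q))).
    apply (continuous_mult (fun q : R3 => / (1 + sinh (snd q) ^ 2))); [exact Cinv |].
    apply (continuous_comp fst snd); [exact C1 | apply continuous_snd].
  + apply (Cg (fun x => sinh x / sqrt (1 + sinh x ^ 2))); intros x.
    pose proof (sqrt1_gt0 (sinh x)) as Hr.
    auto_derive; repeat split; simpl in *; nra.
- intros p [u [_ <-]]; rewrite HN, unit_normal_catenoid; unfold dot; cbn [fst snd].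
  pose proof (sqrt1_gt0 (fst u)); pose proof (sqrt1_sq (fst u)) as E.
  pose proof (sin2_cos2_pow (snd u)) as T.
  set (r := sqrt (1 + fst u ^ 2)) in *.
  transitivity ((fst u ^ 2 + (sin (snd u) ^ 2 + cos (snd u) ^ 2)) / r ^ 2);
    [field; lra |].
  rewrite T, E; field; nra.
- intros u i _; rewrite HN, unit_normalE by exact Logic.I.
  pose proof (sin2_cos2_pow (snd u)) as T.
  destruct i; [rewrite partial3_s | rewrite partial3_phi]; unfold dot; cbn [fst snd];
    [| ring].
  set (r' := Derive _ _); set (h' := Derive _ _).
  transitivity (r' * h' * (1 - (sin (snd u) ^ 2 + cos (snd u) ^ 2)));
    [ring | rewrite T; ring].
Qed.

(** * Images of geodesics under the Gauss map *)

(** The height [e s / r] of the normal is the sine of [e atan s], so its colatitude is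
    [PI / 2 - e atan s], strictly between 0 and [PI]: the poles are avoided. The shift [o] of the
    longitude depends on the sign only. *)
Lemma normal_in_spherical_coordinates (e : R) :
  e = 1 \/ e = -1 -> exists o : R, forall s phi,
    param_dom sphere_without_poles (PI / 2 - e * atan s, phi + o) /\
    sin (PI / 2 - e * atan s) = / sqrt (1 + s ^ 2) /\
    param sphere_without_poles (PI / 2 - e * atan s, phi + o)
    = scal3 e (unit_normal catenoid (s, phi)).
Proof.
intros He.
(* For [e = 1] the normal points towards the axis, which costs half a turn; for [e = -1] it points
   outwards. *)
assert (Ho : exists o, forall phi,
   cos (phi + o) = - e * cos phi /\ sin (phi + o) = - e * sin phi).
{ destruct He as [-> | ->]; [exists PI | exists 0]; intros phi.
  - rewrite neg_cos, neg_sin; lra.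
  - rewrite Rplus_0_r; lra. }
destruct Ho as [o Ho]; exists o; intros s phi.
destruct (Ho phi) as [Hc Hs].
assert (E : sin (PI / 2 - e * atan s) = / sqrt (1 + s ^ 2)).
{ rewrite sin_shift.
  replace (1 + s ^ 2) with (1 + Rsqr s) by (unfold Rsqr; ring).
  rewrite <- (Rmult_1_l (/ _)); fold (1 / sqrt (1 + Rsqr s)); rewrite <- cos_atan.
  destruct He as [-> | ->]; [f_equal; ring |].
  rewrite <- (cos_neg (atan s)); f_equal; ring. }
split; [| split; [exact E |]].
- unfold param_dom; simpl; pose proof (atan_bound s).
  destruct He as [-> | ->]; lra.
- rewrite unit_normal_catenoid; unfold param, scal3.
  cbn [rad hgt sphere_without_poles fst snd]; rewrite E, Hc, Hs, cos_shift.
  replace (sin (e * atan s)) with (e * (s / sqrt (1 + s ^ 2))).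
  { apply pair_equal_spec; (split; [apply pair_equal_spec; split |]); ring. }
  replace (1 + s ^ 2) with (1 + Rsqr s) by (unfold Rsqr; ring).
  rewrite <- sin_atan.
  destruct He as [-> | ->]; [rewrite !Rmult_1_l; reflexivity |].
  replace (-1 * atan s) with (- atan s) by ring; rewrite sin_neg; ring.
Qed.

Lemma gauss_map_geodesic (N : R3 -> R3) (K : R -> Prop) (gamma : R -> R3) :
  gauss_map catenoid N -> is_open_interval K -> geodesic catenoid K gamma ->
  exists (J : R -> Prop) (psi : R -> R), reparametrisation J K psi /\
    geodesic sphere_without_poles J (fun x => N (gamma (psi x))).
Proof.
intros HN HK Hg.
destruct (gauss_map_catenoid_sign N HN) as [e [He HNe]].
destruct (normal_in_spherical_coordinates e He) as [o Ho].
destruct (catenoid_geodesic K gamma HK Hg) as [a [b [d Hl]]].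
destruct (quadratic_time_change a d) as [D [psi [HD [Dpsi Spsi]]]].
assert (Cpsi : forall x, D x -> continuous psi x).
{ intros x Hx; apply (ex_derive_continuous psi); eexists; now apply Dpsi. }
assert (Hpos : forall x, 0 < 1 + (a * psi x + d) ^ 2).
{ intros x; pose proof (pow2_ge_0 (a * psi x + d)); lra. }
assert (Hmono : forall x y, D x -> D y -> x <= y -> psi x <= psi y).
{ intros x y; apply (increasing_of_derive_gt0 D psi _ x y HD Dpsi).
  intros z _; apply Hpos. }
assert (HJ : open (fun x => D x /\ K (psi x))).
{ intros x [Hx HKx]; apply filter_and; [now apply (proj1 HD) |].
  exact (Cpsi x Hx _ (proj1 HK _ HKx)). }
(* The new time interval is the preimage of [K]; it is again an interval because [psi] is
   increasing, and it covers [K] because [psi] is onto. *)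
exists (fun x => D x /\ K (psi x)), psi; split.
- split; [| split; [now intros x [] | split]].
  + split; [exact HJ |]; intros x y z [Hx HKx] [Hz HKz] Hxyz.
    assert (Hy : D y) by now apply (proj2 HD x y z).
    split; [exact Hy |].
    apply (proj2 HK (psi x) _ (psi z)); trivial; split; apply Hmono; tauto.
  + intros t Ht; destruct (Spsi t) as [x [Hx <-]]; now exists x.
  + intros x [Hx HKx]; split; [eexists; now apply Dpsi |]; split.
    (* Second derivatives come from the differential equation, which writes [psi'] as a polynomial
       in [psi] near [x]. *)
    * apply (ex_derive_ext_loc (fun y => 1 + (a * psi y + d) ^ 2)).
      { apply (filter_imp _ _) with (2 := proj1 HD x Hx); intros y Hy.
        symmetry; now apply is_derive_unique, Dpsi. }
      assert (ex_derive psi x) by (eexists; now apply Dpsi).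
      auto_derive; tauto.
    * rewrite (is_derive_unique _ _ _ (Dpsi x Hx)); apply Rgt_not_eq, Hpos.
(* Put [u = a psi + d]. Then [u' = a (1 + u^2)] makes the derivative of [atan u] equal to [a], so
   the colatitude has derivative [- e a]. The longitude has derivative [r^2 (b / r)], which is [b]
   divided by the sine [/ r] of the colatitude. *)
- apply (loxodrome_geodesic _ _ _ (- e * a) b).
  + destruct (proj1 Hg) as [t1 [t2 [H1 [H2 Hne]]]].
    destruct (Spsi t1) as [x1 [Hx1 <-]], (Spsi t2) as [x2 [Hx2 <-]].
    exists x1, x2; split; [tauto |]; split; [tauto |].
    intros E; apply Hne.
    destruct (Hl _ H1) as [f1 L1]; apply locally_singleton in L1.
    destruct (Hl _ H2) as [f2 L2]; apply locally_singleton in L2.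
    destruct L1 as [G1 _], L2 as [G2 _].
    rewrite <- G1, <- G2 in E |- *.
    apply unit_normal_catenoid_inj; rewrite !HNe in E.
    revert E; do 2 destruct (unit_normal _ _) as [[? ?] ?].
    unfold scal3; simpl; intros E; injection E as Ex Ey Ez.
    destruct He as [-> | ->]; apply pair_equal_spec; (split; [apply pair_equal_spec; split |]); lra.
  + intros x0 [Hx0 HK0]; destruct (Hl _ HK0) as [phi Hphi].
    exists (fun x => PI / 2 - e * atan (a * psi x + d)), (fun x => phi (psi x) + o).
    pose proof (filter_and _ _ (proj1 HD x0 Hx0) (Cpsi x0 Hx0 _ Hphi)) as L.
    apply (filter_imp _ _) with (2 := L); clear L.
    intros x [Hx [Hp Dphi]].
    destruct (Ho (a * psi x + d) (phi (psi x))) as [Hd [Hs Hpar]].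
    pose proof (Dpsi x Hx) as Dp.
    split; [exact Hd |]; split; [rewrite Hpar, <- Hp; symmetry; apply HNe |].
    split.
    * assert (DS : is_derive (fun x => a * psi x + d) x
                     (a * (1 + (a * psi x + d) ^ 2))).
      { auto_derive; [eexists; exact Dp |].
        change (Derive (fun y => psi y) x) with (Derive psi x).
        rewrite (is_derive_unique _ _ _ Dp); ring. }
      pose proof (is_derive_comp atan (fun x => a * psi x + d) x _ _
                   (is_derive_atan _) DS) as DA.
      assert (DA' : is_derive (fun x => atan (a * psi x + d)) x a).
      { assert (Ea : a = a * (1 + (a * psi x + d) ^ 2) * / (1 + Rsqr (a * psi x + d)))
          by (unfold Rsqr; field; specialize (Hpos x); lra).
        exact (eq_ind_r (is_derive _ x) DA Ea). }
      replace (- e * a) with (0 - e * a) by ring.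
      apply (is_derive_minus (fun _ => PI / 2)); [apply @is_derive_const |].
      now apply is_derive_scal.
    * cbn [rad sphere_without_poles]; rewrite Hs.
      pose proof (is_derive_comp phi psi x _ _ Dphi Dp) as Dc.
      pose proof (sqrt1_gt0 (a * psi x + d)) as Hr.
      pose proof (sqrt1_sq (a * psi x + d)) as Er.
      rewrite <- Er in Dc at 1.
      set (r := sqrt _) in *.
      replace (b / / r) with (r ^ 2 * (b / r) + 0) by (field; lra).
      apply (is_derive_plus (fun x => phi (psi x))); [exact Dc | apply @is_derive_const].
Qed.

Theorem mainTheorem2 :
  (exists N : R3 -> R3, gauss_map catenoid N) /\
  (forall N : R3 -> R3, gauss_map catenoid N ->
     (forall p : R3, on_surface catenoid p ->
        on_surface sphere_without_poles (N p)) /\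
     (forall (I : R -> Prop) (gamma : R -> R3),
        is_open_interval I -> geodesic catenoid I gamma ->
        exists (J : R -> Prop) (psi : R -> R),
          reparametrisation J I psi /\
          geodesic sphere_without_poles J (fun x => N (gamma (psi x))))) /\
  constant_curvature sphere_without_poles /\
  ~ constant_curvature catenoid.
Proof.
split; [exact gauss_map_catenoid_exists |].
split; [intros N HN; split | split].
- destruct (gauss_map_catenoid_sign N HN) as [e [He HNe]].
  destruct (normal_in_spherical_coordinates e He) as [o Ho].
  intros p [[s phi] [_ <-]].
  destruct (Ho s phi) as [Hd [_ E]].
  eexists; split; [exact Hd |]; now rewrite E, HNe.
- intros I gamma; now apply gauss_map_geodesic.
- exists 1; exact sphere_curvature.
- exact catenoid_curvature_not_constant.
Qed.
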